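(* Let $n+k=N+1$ with $n,k\ge0$. For $k=0,1,2$, one has $\Psi=\Psi_V$ in the graph $G_{n,k}(TU_N)$ of the twisted unknot $TU_N$, where $V$ is the full vertex set, so that $$\frac{\Psi_V^2}{4d^*}=\frac1{16}\left(\frac{2k(k-1)}{N+1}\right)^2\ \le\ \lambda_{\min}\ \le\ \frac{2k(k-1)}{N+1}=4\Psi_V,$$ where $d^*$ is the maximal degree of a vertex in $G_{n,k}(TU_N)$ and $\lambda_{\min}$ is the smallest eigenvalue of the matrix $Q=D+A$ of this graph, i.e. of the Khovanov Laplacian of $TU_N$ in homological degree $0$ and quantum degree $k-n$.
   Context: $TU_N$ is the $N$-crossing unknot diagram given by a vertical stack of $N$ identical crossings of two strands whose two top ends are joined by a cap and two bottom ends by a cup; the crossings are such that the all-0 resolution has $N+1$ circles, numbered $1,\dots,N+1$ along the stack. The Khovanov complex in homological degree $0$ is $\mathcal V^{\otimes(N+1)}$ with $\mathcal V=\mathrm{span}_{\mathbb C}\{\mathbb 1,X\}$ (orthonormal basis), where a labelling with $k$ symbols $\mathbb 1$ and $n$ symbols $X$ has quantum degree $k-n$ (up to an overall shift). The Laplacian in homological degree $0$ is $\Delta_0(TU_N)=\sum_{i=1}^N\mathfrak m_{i,i+1}$, where $\mathfrak m_{ij}$ acts on tensor factors $i,j$ by $\mathbb 1\mathbb 1\mapsto\mathbb 1\mathbb 1$, $\mathbb 1X\mapsto\mathbb 1X+X\mathbb 1$, $X\mathbb 1\mapsto\mathbb 1X+X\mathbb 1$, $XX\mapsto0$, and as the identity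 on the other factors; it preserves the quantum degree, and its restriction to quantum degree $k-n$ is the matrix $Q$ below. $G_{n,k}(TU_N)$ is the weighted graph whose vertex set $V$ consists of the sequences $v_1\cdots v_{N+1}$ with $k$ entries $\mathbb 1$ and $n$ entries $X$. For each $i=1,\dots,N$: there is an edge of weight $1$ between two sequences that differ by swapping unequal entries in positions $i,i+1$, and a loop of weight $\frac12$ is added at each $v$ with $v_i=v_{i+1}=\mathbb 1$. The adjacency matrix $A$ has the edge weights $w_{vv'}$ as entries (loop weights on the diagonal), the degree of $v$ is $\sum_{v'}w_{vv'}$, $D$ is the diagonal matrix of degrees, and $Q=D+A$. For nonempty $S\subset V$: $e_{\min}(S)$ is the minimum total weight of edges (including loops) that must be removed from the induced subgraph on $S$ to make it bipartite; $|cut(S)|$ is the number of edges, counted with weight, having one endpoint in $S$ and the other in $V\setminus S$; $\Psi_S=\dfrac{e_{\min}(S)+|cut(S)|}{|S|}$; and $\Psi=\min_{S\subset V}\Psi_S$.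
   Formalization: The printed equality Ψ_V²/(4d* ) = (1/16)(2k(k-1)/(N+1))² is false for k=2 (N=1: 1/8 vs 1/4); it is replaced by ≤, and the corrected equality Ψ_V²/(4d* ) = (1/16)(k(k-1)/(2(N+1)))² is stated for N≥4; where d*=0 the quotient is read as 0. *)

(* Defs.v *)
From HB Require Import structures.
From mathcomp Require Import all_boot all_order all_algebra all_fingroup.
From mathcomp Require Import reals.
From mathcomp Require Import complex.

Set Implicit Arguments.
Unset Strict Implicit.
Unset Printing Implicit Defensive.

Import Order.TTheory GRing.Theory Num.Theory.
Local Open Scope ring_scope.

Definition smallest (d : Order.disp_t) (T : porderType d) (P : T -> Prop)
    (a : T) : Prop :=
  P a /\ forall b, P b -> (a <= b)%O.

(* A weighted graph on a finite type [T] is a symmetric nonnegative weight     *)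
(* function [w]: [w u v] is the weight of the edge {u, v}, a loop if u = v,    *)
(* and weight 0 means that there is no edge.                                   *)
Section WeightedGraph.
Variables (R : realType) (T : finType) (w : T -> T -> R).

Definition degree (v : T) : R := \sum_(v' : T) w v v'.

Definition max_degree : R := \big[Num.max/0]_(v : T) degree v.

Definition adjacency_mx : 'M[R]_#|T| :=
  \matrix_(i, j) w (enum_val i) (enum_val j).

Definition degree_mx : 'M[R]_#|T| := diag_mx (\row_i degree (enum_val i)).

Definition signless_laplacian_mx : 'M[R]_#|T| := degree_mx + adjacency_mx.

(* Each undirected edge is represented once, by the pair of its endpoints      *)
(* listed in the order of the enumeration of [T].                              *)
Definition induced_edges (S : {set T}) : {set T * T} :=
  [set e | [&& e.1 \in S, e.2 \in S, (enum_rank e.1 <= enum_rank e.2)%N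
             & w e.1 e.2 != 0]].

Definition edge_weight (F : {set T * T}) : R := \sum_(e in F) w e.1 e.2.

Definition bipartite (F : {set T * T}) : bool :=
  [exists c : {ffun T -> bool}, [forall e in F, c e.1 != c e.2]].

(* The default value of the minimum is attained: removing every edge leaves a  *)
(* bipartite graph.                                                            *)
Definition e_min (S : {set T}) : R :=
  \big[Num.min/edge_weight (induced_edges S)]_(F : {set T * T} |
      (F \subset induced_edges S) && bipartite (induced_edges S :\: F))
    edge_weight F.

Definition cut_weight (S : {set T}) : R :=
  \sum_(u in S) \sum_(v in ~: S) w u v.

Definition Psi_of (S : {set T}) : R := (e_min S + cut_weight S) / #|S|%:R.

(* For nonempty [T] the default value is the term at S = [set: T].             *)
Definition Psi : R :=
  \big[Num.min/Psi_of [set: T]]_(S : {set T} | S != set0) Psi_of S.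

End WeightedGraph.

(* A labelling of the circles 1, ..., N+1 (indexed from 0) by the symbols      *)
(* 𝟙 (encoded as [true]) and X (encoded as [false]).                           *)
Definition labelling (N : nat) := {ffun 'I_N.+1 -> bool}.

Definition num1 (N : nat) (v : labelling N) : nat := #|[set i | v i]|.
Definition numX (N : nat) (v : labelling N) : nat := #|[set i | ~~ v i]|.

(* The two circles merged at the crossing [i].                                 *)
Definition above (N : nat) (i : 'I_N) : 'I_N.+1 := widen_ord (leqnSn N) i.
Definition below (N : nat) (i : 'I_N) : 'I_N.+1 := lift ord0 i.

Definition swap_at (N : nat) (i : 'I_N) (v : labelling N) : labelling N :=
  [ffun j => v (tperm (above i) (below i) j)].

Definition TU_vertex (N n k : nat) :=
  {v : labelling N | (num1 v == k) && (numX v == n)}.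

Definition TU_weight (R : realType) (N n k : nat) (v v' : TU_vertex N n k) : R :=
  \sum_(i < N)
    (((val v (above i) != val v (below i))
       && (val v' == swap_at i (val v)))%:R
     + [&& v' == v, val v (above i) & val v (below i)]%:R / 2).

(* The coefficient of c ⊗ d in the image of a ⊗ b under                        *)
(* 𝟙𝟙 ↦ 𝟙𝟙, 𝟙X ↦ 𝟙X + X𝟙, X𝟙 ↦ 𝟙X + X𝟙, XX ↦ 0.                              *)
Definition merge_coef (a b c d : bool) : bool :=
  if a && b then c && d else if a || b then c (+) d else false.

Definition merge_entry (N : nat) (i j : 'I_N.+1) (u v : labelling N) : bool :=
  merge_coef (u i) (u j) (v i) (v j)
    && [forall l, (l != i) && (l != j) ==> (u l == v l)].

(* [f] is the vector \sum_u f(u) u in the basis of labellings.                 *)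
Definition khovanov_laplacian (R : realType) (N : nat)
    (f : {ffun labelling N -> R[i]}) : {ffun labelling N -> R[i]} :=
  [ffun v => \sum_(i < N) \sum_(u : labelling N)
               (merge_entry (above i) (below i) u v)%:R * f u].

Definition quantum_degree (N : nat) (v : labelling N) : int :=
  (num1 v)%:Z - (numX v)%:Z.

Definition khovanov_eigenvalue (R : realType) (N : nat) (q : int) (a : R[i]) :
    Prop :=
  exists f : {ffun labelling N -> R[i]},
    [/\ f != [ffun=> 0],
        forall v, f v != 0 -> quantum_degree v = q
      & khovanov_laplacian f = [ffun v => a * f v]].

(* Main.v *)
Require Import Defs.
From HB Require Import structures.
From mathcomp Require Import all_boot all_order all_algebra all_fingroup.
From mathcomp Require Import reals.
From mathcomp Require Import complex.
From mathcomp Require Import sesquilinear spectral.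
From mathcomp Require Import ring lra zify.

(** For k = 2 write a vertex as the pair i < j of the positions, counted from
0 to N, of the two symbols 𝟙.  The whole statement rests on one explicit
function on the vertices,
  g(i, j) = (i (N - i) + j (N - j) + (N + 1) (j - i)) / (4 (N + 1)),
and on its analogue [potential] for every k.  With
beta = k (k - 1) / (2 (N + 1)) ([Psi_value]) it satisfies
  sum_u w(v, u) (g(v) - g(u)) = beta - w(v, v)
at every vertex v ([potential_laplacian], valid for all k), and for k <= 2 it
varies by at most 1 along an edge ([potential_gradient]).

Away from the loops the graph is bipartite.  Let the m-th height of a
labelling be the number of symbols 𝟙 among its first m entries; swapping two
unequal neighbours changes exactly one height, by one, so the parity of the
sum of the heights is a proper colouring ([height_parity_proper]).
Hence e_min(S) is the loop weight inside S ([e_min_loops]).  Summing the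
equation for g over a set S of vertices, the terms inside S cancel by
antisymmetry and
  beta |S| - loops(S) = sum of w(u, v) (g(u) - g(v)) over the cut <= cut(S).
So Psi_S >= beta for every nonempty S, while S = V has no cut and gives
equality: Psi = Psi_V = beta, with no counting of vertices or loops.  In other
words the gradient of g is a flow, dual to the minimization that defines Psi.

The same g bounds the smallest eigenvalue from below.  The function
h = g + (N + 1) / 2 lies between 1/2 and N + 1, whence
  sum_u w(v, u) (h(v) - h(u)) + 2 w(v, v) h(v) >= beta >= beta^2 h(v);
a positive h with this property forces every eigenvalue of D + A to be at
least beta^2 ([eigenvalue_lower_bound]), which is (1/16) (4 beta)^2; a Cheeger
bound Psi^2 / (4 d) with d = 4, the maximal degree for k = 2 and N >= 4, would
lose a further factor 16.  From above, the Rayleigh quotient of the +1/-1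
colouring is 2 loops(V) / |V| = 2 beta ([signless_smallest]), which is at most
the claimed 4 beta.

Finally the Khovanov Laplacian in quantum degree k - n acts on the labellings
with k symbols 𝟙 and n symbols X exactly as D + A
([khovanov_eigenvalueE]). *)

Set Implicit Arguments.
Unset Strict Implicit.
Unset Printing Implicit Defensive.

Import Order.TTheory GRing.Theory Num.Theory.
Local Open Scope ring_scope.

(** * Smallest eigenvalue of a real symmetric matrix *)

Section SymmetricMatrix.
Local Open Scope complex_scope.
Local Open Scope sesquilinear_scope.

(** The spectral theorem in the orthonormal eigenbasis P: the smallest diagonal
entry bounds the Rayleigh quotient from below.  Complex test vectors are needed
because the Khovanov Laplacian acts on complex vectors; the inequality between
complex numbers then also says that the eigenvalues are real. *)
Lemma symmetric_min_eigenvalue (R : rcfType) n (A : 'M[R]_n) :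
  (0 < n)%N -> A^T = A ->
  exists2 a, eigenvalue A a &
    forall x : 'rV[R[i]]_n,
      a%:C * (x *m x^t*) 0 0 <= (x *m map_mx (real_complex R) A *m x^t*) 0 0.
Proof.
move=> n_gt0 A_sym; set M := map_mx _ A.
have M_herm : M \is hermsymmx.
  apply: realsym_hermsym.
    apply/is_hermitianmxP.
    by rewrite expr0 scale1r map_mx_id // /M map_trmx A_sym.
  by apply/mxOverP => i j; rewrite mxE complex_real.
have/orthomx_spectralP M_diag := hermitian_normalmx M_herm.
have/mxOverP d_real := hermitian_spectral_diag_real M_herm.
move: M_diag d_real (spectral_unitarymx M).
set P := spectralmx M; set d := spectral_diag M => M_diag d_real P_unit.
have [i0 _ d_min] := @arg_minP _ _ _ (Ordinal n_gt0) xpredT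
  (fun i => complex.Re (d 0 i)) isT.
exists (complex.Re (d 0 i0)).
  suff : eigenvalue M (complex.Re (d 0 i0))%:C by rewrite eigenvalue_map.
  rewrite RRe_real //; apply/eigenvalueP; exists (row i0 P).
    rewrite {1}M_diag !mulmxA -row_mul mulmxV ?spectral_unit //.
    by rewrite row1 -rowE row_diag_mx -scalemxAl -rowE.
  apply/eqP => /(congr1 (mulmx^~ (invmx P))) /matrixP /(_ 0 i0) /eqP.
  by rewrite -row_mul mulmxV ?spectral_unit // mul0mx !mxE eqxx oner_eq0.
move=> x; pose y := x *m P^t*.
have -> : x *m x^t* = y *m y^t*.
  by rewrite /y trmx_mul map_mxM trmxCK mulmxA mulmxKtV.
have -> : x *m M *m x^t* = y *m diag_mx d *m y^t*.
  rewrite [in LHS]M_diag invmx_unitary // /y trmx_mul map_mxM trmxCK.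
  by rewrite !mulmxA.
rewrite mxE [leRHS]mxE mulr_sumr; apply: ler_sum => j _.
rewrite mul_mx_diag !mxE mulrAC [leLHS]mulrC.
rewrite ler_wpM2l ?mul_conjC_ge0 // -[d 0 j]RRe_real //.
by rewrite lecR d_min.
Qed.
End SymmetricMatrix.

(** * Edge deletion and isoperimetry in a weighted graph *)

Section Graph.
Variables (R : realType) (T : finType) (w : T -> T -> R).
Hypothesis w_sym : forall u v, w u v = w v u.
Hypothesis w_ge0 : forall u v, 0 <= w u v.

(** A bipartite graph has no loop, so every loop has to be removed; if c properly
colours the rest of the graph, removing the loops is enough. *)
Lemma e_min_loops (c : T -> bool) (S : {set T}) :
  (forall u v, u != v -> w u v != 0 -> c u != c v) ->
  e_min w S = \sum_(v in S) w v v.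
Proof using w_ge0.
move=> c_proper; pose E := induced_edges w S.
pose L := [set e in E | e.1 == e.2].
have L_weight : edge_weight w L = \sum_(v in S) w v v.
  have -> : L = [set (v, v) | v in [set v in S | w v v != 0]].
    apply/setP => -[u v]; rewrite !inE /=; apply/andP/imsetP => /=.
      case=> /and4P[uS _ _ wuv] /eqP uv; subst v.
      by exists u; rewrite ?inE ?uS.
    by case=> x; rewrite inE => /andP[xS wx] [-> ->]; rewrite xS leqnn wx eqxx.
  rewrite /edge_weight big_imset /=; last by move=> u v _ _ [].
  rewrite [RHS](bigID (fun v => w v v != 0)) /= [X in _ + X]big1 ?addr0.
    by apply: eq_bigl => v; rewrite inE.
  by move=> v /andP[_ /negbNE/eqP].
have LE_weight (F : {set T * T}) : F \subset E -> bipartite (E :\: F) ->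
    \sum_(v in S) w v v <= edge_weight w F.
  move=> FE /existsP[col /forallP col_ok]; rewrite -L_weight.
  have LF : L \subset F.
    apply/subsetP => -[u v]; rewrite inE /= => /andP[uvE /eqP uv].
    apply/negbNE/negP => uvF; have /implyP := col_ok (u, v).
    by rewrite inE uvF uvE uv eqxx => /(_ isT).
  by rewrite /edge_weight [leRHS](big_setID L) /= (setIidPr LF) lerDl sumr_ge0.
apply/le_anti/andP; split.
  apply: (@bigmin_inf _ _ _ _ L); last by rewrite L_weight.
  apply/andP; split; first by apply/subsetP => e; rewrite inE => /andP[].
  apply/existsP; exists (finfun c).
  apply/forallP => -[u v]; apply/implyP; rewrite !inE /= !ffunE negb_and.
  case/andP => nL /and4P[uS vS uv wuv]; apply: c_proper => //.
  by move: nL; rewrite uS vS uv wuv.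
apply: le_bigmin => [|F /andP[]]; last exact: LE_weight.
apply: LE_weight => //; rewrite setDv; apply/existsP; exists [ffun=> true].
by apply/forallP => e; rewrite inE.
Qed.

Variables (beta : R) (g : T -> R).
Hypothesis g_lap : forall u, \sum_v w u v * (g u - g v) = beta - w u u.

(** A discrete divergence theorem: the terms with both endpoints in S cancel
because w is symmetric and g u - g v is antisymmetric. *)
Lemma laplacian_sum_cut (S : {set T}) :
  \sum_(u in S) (beta - w u u) =
    \sum_(u in S) \sum_(v in ~: S) w u v * (g u - g v).
Proof using w_sym g_lap.
pose X := \sum_(u in S) \sum_(v in S) w u v * (g u - g v).
have X0 : X = 0.
  have : X = - X.
    rewrite {1}/X exchange_big /= /X -sumrN; apply: eq_bigr => u _.
    by rewrite -sumrN; apply: eq_bigr => v _; rewrite w_sym; ring.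
  lra.
transitivity (X + \sum_(u in S) \sum_(v in ~: S) w u v * (g u - g v)).
  rewrite /X -big_split /=; apply: eq_bigr => u _.
  rewrite -g_lap (bigID (mem S)) /=; congr (_ + _).
  by apply: eq_bigl => v; rewrite inE.
by rewrite X0 add0r.
Qed.

(** The divergence theorem for the full vertex set, whose cut is empty. *)
Lemma loop_sum : \sum_u w u u = beta * #|T|%:R.
Proof using w_sym g_lap.
have := laplacian_sum_cut setT.
under [RHS]eq_bigr => u _ do rewrite setCT big_set0.
rewrite sumrB big1_eq => /subr0_eq.
rewrite sumr_const cardsT mulr_natr => ->.
by apply: eq_bigl => u; rewrite inE.
Qed.

(** Weak duality: the gradient of g is a flow of size at most w on each edge that
carries beta out of each vertex, and it can only leave S through its loops or
its cut. *)
Lemma isoperimetry (S : {set T}) :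
  (forall u v, w u v != 0 -> g u - g v <= 1) ->
  beta * #|S|%:R <= \sum_(v in S) w v v + cut_weight w S.
Proof using w_sym w_ge0 g_lap.
move=> grad_le1; rewrite -lerBlDl mulr_natr -sumr_const -sumrB.
rewrite laplacian_sum_cut; apply: ler_sum => u _; apply: ler_sum => v _.
have [->|] := eqVneq (w u v) 0; first by rewrite mul0r.
by move=> /grad_le1; exact: ler_piMr.
Qed.

Lemma Psi_setT (c : T -> bool) :
  (forall u v, u != v -> w u v != 0 -> c u != c v) -> (0 < #|T|)%N ->
  Psi_of w setT = beta.
Proof using w_sym w_ge0 g_lap.
move=> c_proper T_gt0; rewrite /Psi_of (e_min_loops _ c_proper) /cut_weight.
under [X in _ + X]eq_bigr => u _ do rewrite setCT big_set0.
rewrite big1_eq addr0 cardsT.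
have -> : \sum_(v in setT) w v v = \sum_v w v v.
  by apply: eq_bigl => v; rewrite inE.
by rewrite loop_sum mulfK // pnatr_eq0 -lt0n.
Qed.

Lemma Psi_minimum (c : T -> bool) :
  (forall u v, u != v -> w u v != 0 -> c u != c v) -> (0 < #|T|)%N ->
  (forall u v, w u v != 0 -> g u - g v <= 1) ->
  Psi w = Psi_of w setT.
Proof using w_sym w_ge0 g_lap.
move=> c_proper T_gt0 grad_le1; apply/le_anti/andP; split.
  by apply: bigmin_le_id.
apply: le_bigmin => // S S0; rewrite (Psi_setT c_proper) //.
rewrite /Psi_of (e_min_loops _ c_proper) ler_pdivlMr; last first.
  by rewrite ltr0n card_gt0.
exact: isoperimetry.
Qed.

End Graph.

(** * Eigenvalues of the signless Laplacian *)

Section Signless.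
Variables (R : realType) (T : finType) (w : T -> T -> R).
Hypothesis w_sym : forall u v, w u v = w v u.
Hypothesis w_ge0 : forall u v, 0 <= w u v.

Lemma signless_sym : (signless_laplacian_mx w)^T = signless_laplacian_mx w.
Proof using w_sym.
apply/matrixP => i j; rewrite !mxE w_sym eq_sym.
by case: eqVneq => // ->.
Qed.

(** D + A acts on a function x by summing w u v (x u + x v) over u.  The morphism
phi makes the formula available both for real and for complex x. *)
Lemma mul_signless (K : comNzRingType) (phi : {rmorphism R -> K})
    (x : 'rV[K]_#|T|) j :
  (x *m map_mx phi (signless_laplacian_mx w)) 0 j =
    \sum_u phi (w u (enum_val j)) * (x 0 (enum_rank u) + x 0 j).
Proof using w_sym.
rewrite mxE; under eq_bigr => i _ do rewrite !mxE rmorphD mulrDr.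
rewrite big_split /= (bigD1 j) //= eqxx mulr1n big1 ?addr0; last first.
  by move=> i ij; rewrite (negbTE ij) mulr0n rmorph0 mulr0.
under [RHS]eq_bigr => u _ do rewrite mulrDr.
rewrite big_split /= addrC; congr (_ + _).
  rewrite (reindex (@enum_rank T)) /=; last first.
    by exists enum_val => i _; rewrite ?enum_rankK ?enum_valK.
  by apply: eq_bigr => u _; rewrite enum_rankK mulrC.
rewrite /degree rmorph_sum mulr_sumr; apply: eq_bigr => u _.
by rewrite mulrC w_sym.
Qed.

(** Barta's method.  At a vertex where |x| / h is largest, each neighbour
contributes at least what it would if x were, up to scaling, equal to h there
and to - h on the neighbour, and the hypothesis on h bounds that case. *)
Lemma eigenvalue_lower_bound (lambda a : R) (h : T -> R) :
  (forall u, 0 < h u) ->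
  (forall u, lambda * h u <= \sum_v w u v * (h u - h v) + 2 * w u u * h u) ->
  eigenvalue (signless_laplacian_mx w) a -> lambda <= a.
Proof using w_sym w_ge0.
move=> h_gt0 h_super /eigenvalueP[x xQ x_neq0].
pose r u := x 0 (enum_rank u) / h u.
have xE u : x 0 (enum_rank u) = r u * h u by rewrite mulfVK ?gt_eqF.
have xQE u : a * (r u * h u) = \sum_v w u v * (r v * h v + r u * h u).
  have /rowP/(_ (enum_rank u)) := xQ; rewrite [RHS]mxE -xE => <-.
  rewrite -[signless_laplacian_mx w](map_mx_id (f := idfun)) // mul_signless.
  by apply: eq_bigr => v _; rewrite enum_rankK w_sym !xE.
have /rV0Pn[i xi_neq0] := x_neq0.
have [u _ u_max] := @arg_maxP _ _ _ (enum_val i) xpredT (fun u => `|r u|) isT.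
have r2_gt0 : 0 < r u ^+ 2.
  rewrite exprn_even_gt0 //= -normr_gt0.
  apply: lt_le_trans (u_max (enum_val i) isT).
  by rewrite normr_gt0 mulf_neq0 ?enum_valK // invr_neq0 // gt_eqF.
rewrite -(ler_pM2r (mulr_gt0 r2_gt0 (h_gt0 u))).
have -> : a * (r u ^+ 2 * h u) = r u * (a * (r u * h u)) by ring.
rewrite xQE mulr_sumr mulrCA.
apply: (le_trans (ler_wpM2l (ltW r2_gt0) (h_super u))).
rewrite (bigD1 u) // [leRHS](bigD1 u) //= subrr mulr0 add0r mulrDr addrC.
apply: lerD; last by rewrite le_eqVlt; apply/orP; left; apply/eqP; ring.
rewrite mulr_sumr; apply: ler_sum => v _.
rewrite [leLHS]mulrCA [leRHS]mulrCA ler_wpM2l //.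
have : `|r v * r u| <= r u ^+ 2.
  rewrite normrM -(real_normK (num_real (r u))) expr2.
  by apply: ler_wpM2r; [exact: normr_ge0 | exact: u_max].
rewrite ler_norml => /andP[rr _].
have := ler_wpM2r (ltW (h_gt0 v)) rr; lra.
Qed.

Local Open Scope complex_scope.
Local Open Scope sesquilinear_scope.

(** The test vector for the upper bound is the sign vector of the colouring c: on
it every edge contributes 0 and every loop w u u contributes 2 w u u. *)
Lemma signless_smallest (c : T -> bool) :
  (0 < #|T|)%N ->
  (forall u v, u != v -> w u v != 0 -> c u != c v) ->
  let Q := signless_laplacian_mx w in
  exists a : R,
    [/\ smallest (eigenvalue Q) a,
        smallest (eigenvalue (map_mx (real_complex R) Q)) a%:C
      & a * #|T|%:R <= 2 * \sum_u w u u].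
Proof using w_sym.
move=> T_gt0 c_proper Q.
have [a aQ a_min] := symmetric_min_eigenvalue T_gt0 signless_sym.
have aCQ : smallest (eigenvalue (map_mx (real_complex R) Q)) a%:C.
  split=> [|b /eigenvalueP[x xQ x_neq0]]; first by rewrite eigenvalue_map.
  have xx_gt0 : 0 < (x *m x^t*) 0 0 by rewrite -dotmxE dnorm_gt0.
  by have := a_min x; rewrite -/Q xQ -scalemxAl [leRHS]mxE ler_pM2r.
exists a; split => //.
  by split=> // b bQ; rewrite -lecR; apply: aCQ.2; rewrite eigenvalue_map.
pose s u : R := (-1) ^+ c u.
pose x : 'rV[R[i]]_#|T| := \row_i (s (enum_val i))%:C.
have xC i : (x^t*) i 0 = x 0 i by rewrite !mxE conj_Creal ?complex_real.
have ss u : (s u)%:C * (s u)%:C = 1 by rewrite -rmorphM -expr2 sqrr_sign.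
have sN u v : u != v -> w u v != 0 -> s u = - s v.
  move=> uv /(c_proper _ _ uv); rewrite /s.
  by case: (c u) (c v) => [] [] //; rewrite expr0 expr1 ?opprK.
have xxE : (x *m x^t*) 0 0 = #|T|%:R%:C.
  rewrite mxE; under eq_bigr => i _ do rewrite xC mxE ss.
  by rewrite sumr_const card_ord rmorph_nat.
have xQxE : (x *m map_mx (real_complex R) Q *m x^t*) 0 0 =
    (2 * \sum_u w u u)%:C.
  rewrite mxE mulr_sumr rmorph_sum (reindex (@enum_rank T)) /=; last first.
    by exists enum_val => i _; rewrite ?enum_rankK ?enum_valK.
  apply: eq_bigr => v _; rewrite xC mul_signless enum_rankK.
  rewrite (bigD1 v) //= big1 ?addr0 => [|u uv]; rewrite !mxE !enum_rankK.
    by rewrite -mulrA mulrDl ss mulrDr mulr1 -rmorphD -mulr2n mulr_natl.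
  have [->|wuv] := eqVneq (w u v) 0; first by rewrite mul0r.
  by rewrite (sN u v) // rmorphN addNr mulr0.
by have := a_min x; rewrite xxE xQxE -rmorphM lecR.
Qed.
End Signless.

(** * Labellings and their heights *)

Section Heights.
Variable N : nat.
Implicit Types (v : labelling N) (i : 'I_N).

(** Sites and heights are indexed by natural numbers so that sums over the
crossings can telescope. *)
Definition site v (j : nat) : bool := v (inord j).

Definition height v (m : nat) : nat := \sum_(j < m) site v j.

Lemma site_above v i : v (above i) = site v i.
Proof.
by congr (v _); apply: val_inj; rewrite /= inordK // ltnS ltnW.
Qed.

Lemma site_below v i : v (below i) = site v i.+1.
Proof. by congr (v _); apply: val_inj; rewrite /= inordK // ltnS. Qed.

Lemma heightS v m : height v m.+1 = (height v m + site v m)%N.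
Proof. by rewrite /height big_ord_recr. Qed.

Lemma height_full v : height v N.+1 = num1 v.
Proof.
rewrite /num1 -sum1dep_card big_mkcond; apply: eq_bigr => j _.
by rewrite /site inord_val; case: (v j).
Qed.

Lemma height_le v m1 m2 : (m1 <= m2)%N -> (height v m1 <= height v m2)%N.
Proof.
move/subnK <-; elim: (m2 - m1)%N => // d /leq_trans -> //.
by rewrite addSn heightS leq_addr.
Qed.

Lemma num1X v : (num1 v + numX v)%N = N.+1.
Proof.
rewrite /num1 /numX -[RHS](card_ord N.+1) -(cardsC [set j | v j]).
by congr (_ + #|pred_of_set _|)%N; apply/setP => j; rewrite !inE.
Qed.

Lemma swap_at_above i v : swap_at i v (above i) = v (below i).
Proof. by rewrite ffunE tpermL. Qed.

Lemma swap_at_below i v : swap_at i v (below i) = v (above i).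
Proof. by rewrite ffunE tpermR. Qed.

Lemma swap_at_out i v j : j != above i -> j != below i -> swap_at i v j = v j.
Proof. by move=> ja jb; rewrite ffunE tpermD // eq_sym. Qed.

Lemma swap_atK i : involutive (@swap_at N i).
Proof. by move=> v; apply/ffunP => j; rewrite !ffunE tpermK. Qed.

Lemma num1_swap i v : num1 (swap_at i v) = num1 v.
Proof.
have inj := perm_inj (s := tperm (above i) (below i)).
rewrite /num1 -(card_preimset [set j | v j] inj).
by apply: eq_card => j; rewrite !inE ffunE.
Qed.

Lemma numX_swap i v : numX (swap_at i v) = numX v.
Proof. by apply: (@addnI (num1 v)); rewrite -{1}(num1_swap i) !num1X. Qed.

(** A swap at the crossing i moves at most one symbol across the boundary between
positions i and i + 1, so it only affects the height there. *)
Lemma height_swap i v m : (m <= N.+1)%N ->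
  height (swap_at i v) m =
    if m == i.+1 then (height v i + site v i.+1)%N else height v m.
Proof.
have site_swap j : (j <= N)%N -> site (swap_at i v) j =
    if j == i then site v i.+1 else if j == i.+1 then site v i else site v j.
  move=> jN; have jE : val (inord j : 'I_N.+1) = j by rewrite /= inordK.
  case: eqVneq => [->|ji].
    by rewrite -site_above swap_at_above site_below.
  case: eqVneq => [->|ji1].
    by rewrite -site_below swap_at_below site_above.
  by rewrite /site swap_at_out // -val_eqE jE //= /bump /= add1n.
elim: m => [|m IH] mN; first by rewrite /height !big_ord0.
rewrite heightS IH ?(ltnW mN) // site_swap // eqSS.
have [->|mi] := eqVneq m i; first by rewrite ltn_eqF.
by have [->|_] := eqVneq m i.+1; rewrite !heightS // addnAC.
Qed.

End Heights.

(** * The weights of the graph *)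

Section Weights.
Variables (R : realType) (N n k : nat).
Local Notation V := (TU_vertex N n k).
Local Notation w := (@TU_weight R N n k).

Lemma weight_ge0 (u v : V) : 0 <= w u v.
Proof. by apply: sumr_ge0 => i _; rewrite addr_ge0 // ?mulr_ge0 ?invr_ge0. Qed.

Lemma weight_sym (u v : V) : w u v = w v u.
Proof.
apply: eq_bigr => i _.
congr ((nat_of_bool _)%:R + (nat_of_bool _)%:R / 2); last first.
  by have [->|_] := eqVneq v u.
apply/andP/andP => -[neq /eqP ->]; rewrite swap_at_above swap_at_below swap_atK.
  by rewrite eq_sym neq eqxx.
by rewrite eq_sym neq eqxx.
Qed.

Lemma weight_loop (v : V) :
  w v v = \sum_(i < N) (val v (above i) && val v (below i))%:R / 2.
Proof.
apply: eq_bigr => i _; rewrite eqxx /=.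
case: eqVneq => [_|neq]; first by rewrite add0r.
have -> : val v == swap_at i (val v) = false.
  by apply/eqP => vE; move: neq; rewrite {2}vE swap_at_below eqxx.
by rewrite add0r.
Qed.

Lemma swap_vertex_subproof i (v : V) :
  (num1 (swap_at i (val v)) == k) && (numX (swap_at i (val v)) == n).
Proof. by rewrite num1_swap numX_swap (valP v). Qed.

Definition swap_vertex i (v : V) : V :=
  Sub (swap_at i (val v)) (swap_vertex_subproof i v).

(** The neighbours of v are its swaps; phi serves to sum real as well as complex
values. *)
Lemma weight_sum (K : comNzRingType) (phi : {rmorphism R -> K}) (v : V)
    (F : labelling N -> K) :
  \sum_u phi (w v u) * F (val u) =
    \sum_(i < N)
      ((val v (above i) != val v (below i))%:R * F (swap_at i (val v))
      + (val v (above i) && val v (below i))%:R * phi (1 / 2) * F (val v)).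
Proof.
under eq_bigr => u _ do rewrite rmorph_sum mulr_suml.
rewrite exchange_big /=; apply: eq_bigr => i _.
under eq_bigr => u _ do rewrite rmorphD mulrDl rmorph_nat.
rewrite big_split /=; congr (_ + _).
  rewrite (bigD1 (swap_vertex i v)) //= eqxx andbT big1 ?addr0 // => u.
  by rewrite -val_eqE /= => /negbTE ->; rewrite andbF mul0r.
rewrite (bigD1 v) //= eqxx big1 ?addr0 => [|u /negbTE ->].
  by rewrite -(rmorph_nat phi) -rmorphM mul1r.
by rewrite mul0r rmorph0 mul0r.
Qed.

Lemma weight_neq0 (u v : V) : u != v -> w u v != 0 ->
  exists i : 'I_N, val u (above i) != val u (below i) /\
                   val v = swap_at i (val u).
Proof.
rewrite eq_sym => /negbTE uv wuv.
have /existsP[i /andP[ui /eqP vi]] : [exists i : 'I_N,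
  (val u (above i) != val u (below i)) && (val v == swap_at i (val u))].
  apply: contraNT wuv => /existsPn none; apply/eqP/big1 => i _.
  by rewrite uv (negbTE (none i)) mul0r addr0.
by exists i.
Qed.

Definition height_parity (v : V) : bool :=
  odd (\sum_(i < N) height (val v) i.+1).

(** A swap of unequal entries changes a single height, by exactly one. *)
Lemma height_parity_proper (u v : V) :
  u != v -> w u v != 0 -> height_parity u != height_parity v.
Proof.
move=> uv /(weight_neq0 uv)[i []]; rewrite site_above site_below => ui vE.
rewrite /height_parity vE (bigD1 i) // [X in _ != odd X](bigD1 i) //=.
rewrite height_swap ?eqxx ?ltnS 1?ltnW // heightS.
have -> : (\sum_(j < N | j != i) height (swap_at i (val u)) j.+1 =
    \sum_(j < N | j != i) height (val u) j.+1)%N.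
  apply: eq_bigr => j ji.
  by rewrite height_swap ?ltnS 1?ltnW // eqSS val_eqE (negbTE ji).
rewrite !oddD; move: ui.
by case: (site _ i) (site _ i.+1) => [] [] //= _; case: (odd _); case: (odd _).
Qed.

End Weights.

(** * The potential *)

Section Potential.
Variables (R : realType) (N n k : nat).
Local Notation V := (TU_vertex N n k).
Local Notation w := (@TU_weight R N n k).

Lemma num1_vertex (v : V) : num1 (val v) = k.
Proof. by case/andP: (valP v) => /eqP. Qed.

Lemma height_vertex (v : V) m : (m <= N.+1)%N -> (height (val v) m <= k)%N.
Proof.
by move=> mN; rewrite -[leqRHS](num1_vertex v) -height_full height_le.
Qed.

(** Summed over the crossings, these terms give
((k - 1) sum of p (N - p) + (N + 1) sum of |p - q|) / (4 (N + 1)),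
where p runs over the positions of the symbols 𝟙 and {p, q} over the pairs of
such positions.  In terms of heights each swap changes only one summand. *)
Definition potential_term (c s : nat) : R :=
  s%:R * (N.+1%:R * (k%:R - s%:R) - (k%:R - 1) * (N%:R - 2 * c%:R - 1))
    / (4 * N.+1%:R).

Definition potential (v : labelling N) : R :=
  \sum_(i < N) potential_term i (height v i.+1).

(** The common value of Psi and Psi_V, called beta above. *)
Definition Psi_value : R := k%:R * (k%:R - 1) / (2 * N.+1%:R).

Lemma potential_swap i v :
  potential v - potential (swap_at i v) =
    potential_term i (height v i + site v i)
    - potential_term i (height v i + site v i.+1).
Proof.
rewrite /potential (bigD1 i) // [X in _ - X](bigD1 i) //=.
rewrite height_swap ?eqxx ?ltnS 1?ltnW // heightS.
have -> : \sum_(j < N | j != i) potential_term j (height (swap_at i v) j.+1) =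
    \sum_(j < N | j != i) potential_term j (height v j.+1).
  apply: eq_bigr => j ji.
  by rewrite height_swap ?ltnS 1?ltnW // eqSS val_eqE (negbTE ji).
by rewrite opprD addrACA subrr addr0.
Qed.

(** The divergence of the gradient of the potential is constant except for the
loops, each pair of adjacent symbols 𝟙 blocking the two swaps that would bring
them closer. *)
Lemma potential_laplacian (v : V) :
  \sum_u w v u * (potential (val v) - potential (val u)) = Psi_value - w v v.
Proof.
have N1_neq0 : N%:R + 1 != 0 :> R by rewrite natr1 pnatr_eq0.
rewrite (weight_sum idfun v (fun x => potential (val v) - potential x)).
(* The sum over the crossings telescopes.  With h the number of symbols 𝟙
   before position j, x the entry there and y the next one, the summand is, up
   to the factor 2 / (4 (N + 1)),
   (k - 1) (j + 1) (x - y) + (N + 1) ((h + x) y - h x),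
   and (j + 1) (x - y) is the increment of h - j x. *)
pose U j : R :=
  (2 * (k%:R - 1) * ((height (val v) j)%:R - j%:R * (site (val v) j)%:R)
   + 2 * N.+1%:R * (height (val v) j)%:R * (site (val v) j)%:R)
  / (4 * N.+1%:R).
apply/eqP; rewrite eq_sym subr_eq eq_sym; apply/eqP.
rewrite weight_loop -big_split /=.
transitivity (\sum_(0 <= j < N) (U j.+1 - U j)).
  rewrite big_mkord; apply: eq_bigr => i _.
  rewrite subrr mulr0 addr0 potential_swap site_above site_below /=.
  rewrite /U heightS /potential_term -[i.+1%:R]natr1 -[N.+1%:R]natr1 !natrD.
  by case: (site _ i) (site _ i.+1) => [] [] /=; field.
rewrite telescope_sumr //.
have kE : k%:R = (height (val v) N)%:R + (site (val v) N)%:R :> R.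
  by rewrite -natrD -heightS height_full num1_vertex.
have -> : U 0%N = 0.
  by rewrite /U /height big_ord0 !(mul0r, mulr0, subr0, addr0).
rewrite /U /Psi_value kE -[N.+1%:R]natr1 subr0.
by case: (site _ N) => /=; field.
Qed.

Hypothesis k_le2 : (k <= 2)%N.

(** The restriction k <= 2 is essential here: for larger k the terms grow with k
while their denominator does not. *)
Lemma potential_term_bound (c s : nat) :
  (c < N)%N -> (s <= k)%N -> `|potential_term c s| <= 1 / 2.
Proof using k_le2.
move=> cN sk; have N_gt0 : 0 < N%:R + 1 :> R by rewrite natr1 ltr0n.
have cNR : c%:R + 1 <= N%:R :> R by rewrite natr1 ler_nat.
have c0 : 0 <= c%:R :> R by [].
rewrite /potential_term normrM normfV (gtr0_norm (x := 4 * _)); last first.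
  by rewrite mulr_gt0 // ltr0n.
rewrite ler_pdivrMr; last by rewrite mulr_gt0 // ltr0n.
rewrite -natr1 ler_norml.
case: (k) k_le2 s sk => [|[|[|]]] // _ [|[|[|]]] // _;
  by apply/andP; split; lra.
Qed.

Lemma potential_bound (v : V) : `|potential (val v)| <= N%:R / 2.
Proof using k_le2.
apply: (le_trans (ler_norm_sum _ _ _)).
have -> : N%:R / 2 = \sum_(i < N) 1 / 2 :> R.
  by rewrite sumr_const card_ord -[RHS]mulr_natl mul1r.
apply: ler_sum => i _; apply: potential_term_bound => //.
by apply: height_vertex; rewrite ltnS ltnW.
Qed.

(** A swap replaces a single term of the potential, and each term is at most 1/2
in absolute value. *)
Lemma potential_gradient (u v : V) :
  w u v != 0 -> potential (val u) - potential (val v) <= 1.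
Proof using k_le2.
have [->|uv] := eqVneq u v; first by rewrite subrr ler01.
case/(weight_neq0 uv) => i [_ ->]; rewrite potential_swap.
have i2k : (height (val u) i.+2 <= k)%N by apply: height_vertex; rewrite !ltnS.
have b1 : `|potential_term i (height (val u) i + site (val u) i)| <= 1 / 2.
  apply: potential_term_bound => //; apply: leq_trans i2k.
  by rewrite !heightS leq_addr.
have b2 : `|potential_term i (height (val u) i + site (val u) i.+1)| <= 1 / 2.
  apply: potential_term_bound => //; apply: leq_trans i2k.
  by rewrite !heightS addnAC leq_addr.
move: b1 b2; rewrite !ler_norml => /andP[_ b1] /andP[b2 _]; lra.
Qed.

(** The shift by (N + 1) / 2 makes h at least 1/2, so that the loop part
2 w v v h v compensates the loss of w v v in the equation of the potential, and
keeps h at most N + 1, so that Psi_value h <= 1. *)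
Lemma potential_superharmonic (v : V) :
  let h u := potential (val u) + N.+1%:R / 2 in
  0 < h v /\
  Psi_value ^+ 2 * h v <= \sum_u w v u * (h v - h u) + 2 * w v v * h v.
Proof using k_le2.
move=> h.
have := potential_bound v; rewrite ler_norml => /andP[g_ge g_le].
have h_ge : 1 / 2 <= h v by rewrite /h -[N.+1%:R]natr1; lra.
have N_ge0 : 0 <= N%:R :> R by [].
have h_le : h v <= N.+1%:R by rewrite /h -[N.+1%:R]natr1; lra.
split; first lra.
have -> : \sum_u w v u * (h v - h u) = Psi_value - w v v.
  rewrite -potential_laplacian; apply: eq_bigr => u _.
  by rewrite /h opprD addrACA subrr addr0.
have N_gt0 : 0 < N.+1%:R :> R by rewrite ltr0n.
have [Psi_ge0 Psi_le] : 0 <= Psi_value /\ Psi_value * N.+1%:R <= 1.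
  have -> : Psi_value = k%:R * (k%:R - 1) / 2 / N.+1%:R.
    by rewrite /Psi_value invfM mulrA.
  have [t_ge0 t_le1] : 0 <= k%:R * (k%:R - 1) / 2 :> R /\
      k%:R * (k%:R - 1) / 2 <= 1 :> R.
    by case: (k) k_le2 => [|[|[|]]] // _; split; lra.
  by rewrite mulfVK ?gt_eqF // mulr_ge0 // invr_ge0 ltW.
have w_loop : 0 <= w v v by apply: weight_ge0.
have Psih : Psi_value * h v <= 1.
  by apply: le_trans Psi_le; rewrite ler_wpM2l.
have := ler_wpM2l Psi_ge0 Psih; have := ler_wpM2l w_loop h_ge.
by rewrite expr2; lra.
Qed.

End Potential.

(** * The Khovanov Laplacian *)

Section Khovanov.
Local Open Scope complex_scope.
Variables (R : realType) (N n k : nat).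
Local Notation V := (TU_vertex N n k).
Local Notation w := (@TU_weight R N n k).
Local Notation Q := (signless_laplacian_mx w).

(** The coefficient of v in the merge of u: a labelling contributes to itself,
unless both symbols are X, and to its swap if the two symbols differ. *)
Lemma merge_entryE (i : 'I_N) (u v : labelling N) :
  merge_entry (above i) (below i) u v =
    (u == v) && (v (above i) || v (below i))
    || (v (above i) != v (below i)) && (u == swap_at i v).
Proof.
rewrite /merge_entry; set rest := [forall l, _].
have restP : reflect (forall l, l != above i -> l != below i -> u l = v l) rest.
  apply: (iffP forallP) => H l.
    by move=> la lb; have := H l; rewrite la lb => /eqP.
  by apply/implyP => /andP[la lb]; rewrite H.
have split_eq (x : labelling N) :
    (forall l, l != above i -> l != below i -> x l = v l) ->
    (u == x) =
      [&& u (above i) == x (above i), u (below i) == x (below i) & rest].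
  move=> xv; apply/eqP/and3P => [ux | [/eqP ua /eqP ub /restP ur]].
    by rewrite !ux; split=> //; apply/restP => l la lb; rewrite ux xv.
  apply/ffunP => l; have [->|la] := eqVneq l (above i); first by [].
  have [->|lb] := eqVneq l (below i); first by [].
  by rewrite ur // xv.
rewrite (split_eq v) // (split_eq (swap_at i v)); last exact: swap_at_out.
rewrite swap_at_above swap_at_below.
by case: (rest); case: (u (above i)); case: (u (below i));
   case: (v (above i)); case: (v (below i)).
Qed.

Lemma khovanov_laplacianE (f : {ffun labelling N -> R[i]}) v :
  khovanov_laplacian f v =
    \sum_(i < N) ((v (above i) || v (below i))%:R * f v
                  + (v (above i) != v (below i))%:R * f (swap_at i v)).
Proof.
rewrite ffunE; apply: eq_bigr => i _.
rewrite (eq_bigr (fun u => ((u == v) && (v (above i) || v (below i)))%:R * f u +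
   ((v (above i) != v (below i)) && (u == swap_at i v))%:R * f u)); last first.
  move=> u _; rewrite merge_entryE -mulrDl -natrD; congr (_%:R * _).
  have [->|_] /= := eqVneq u v; last by [].
  have [vab|vab] := eqVneq (v (above i)) (v (below i)).
    by rewrite orbF addn0.
  case: eqVneq => [vE|_]; last by rewrite orbF addn0.
  by move: vab; rewrite vE swap_at_above swap_at_below {1}vE swap_at_below eqxx.
rewrite big_split (bigD1 v) // [X in _ + X = _](bigD1 (swap_at i v)) //=.
rewrite !eqxx andbT.
rewrite !big1 ?addr0 // => u /negbTE ->; first by rewrite andbF mul0r.
by rewrite mul0r.
Qed.

(** A pair 𝟙𝟙 contributes 1 to the diagonal of the Khovanov Laplacian; in D + A
its loop of weight 1/2 is counted once in the degree and once in A. *)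
Lemma khovanov_signless (f : {ffun labelling N -> R[i]}) (v : V) :
  khovanov_laplacian f (val v) =
    \sum_u (w u v)%:C * (f (val u) + f (val v)).
Proof.
rewrite khovanov_laplacianE; under [RHS]eq_bigr => u _ do rewrite weight_sym.
rewrite (weight_sum (real_complex R) v (fun x => f x + f (val v))).
apply: eq_bigr => i _.
have half : (1 / 2 : R)%:C + (1 / 2 : R)%:C = 1 by rewrite -rmorphD -splitr.
rewrite -mulrA [_%:C * _]mulrDr -mulrDl half.
by case: (val v (above i)) (val v (below i)) => [] [] /=; ring.
Qed.

Lemma mem_vertex (hnk : (n + k)%N = N.+1) (v : labelling N) :
  quantum_degree v = k%:Z - n%:Z <-> (num1 v == k) && (numX v == n).
Proof.
have := num1X v; rewrite /quantum_degree => vN.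
by split=> [H|/andP[/eqP -> /eqP ->] //]; apply/andP; split; apply/eqP; lia.
Qed.

(** The vertices of the graph are exactly the labellings of quantum degree k - n,
and the Khovanov Laplacian preserves the functions supported on them. *)
Lemma khovanov_eigenvalueE (hnk : (n + k)%N = N.+1) (a : R[i]) :
  @khovanov_eigenvalue R N (k%:Z - n%:Z) a <->
  eigenvalue (map_mx (real_complex R) Q) a.
Proof.
split=> [[f [f_neq0 f_supp f_eig]]|/eigenvalueP[x xQ x_neq0]].
  have f0 v : ~~ ((num1 v == k) && (numX v == n)) -> f v = 0.
    move=> vV; apply/eqP; apply: contraNT vV => /f_supp.
    by move/(mem_vertex hnk).
  apply/eigenvalueP; exists (\row_j f (val (enum_val j))).
    apply/rowP => j; rewrite mul_signless; last exact: weight_sym.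
    have := congr1 (fun h : {ffun _ -> _} => h (val (enum_val j))) f_eig.
    rewrite khovanov_signless ffunE !mxE => <-; apply: eq_bigr => u _.
    by rewrite !mxE enum_rankK.
  apply: contraNneq f_neq0 => /rowP x0; apply/eqP/ffunP => v; rewrite ffunE.
  have [vV|/f0 //] := boolP ((num1 v == k) && (numX v == n)).
  by have := x0 (enum_rank (Sub v vV : V)); rewrite !mxE enum_rankK SubK.
pose f : {ffun labelling N -> R[i]} :=
  [ffun v => if insub v is Some t then x 0 (enum_rank (t : V)) else 0].
have fE (t : V) : f (val t) = x 0 (enum_rank t) by rewrite ffunE valK.
have f0 v : ~~ ((num1 v == k) && (numX v == n)) -> f v = 0.
  by move=> vV; rewrite ffunE insubN.
exists f; split.
- apply: contraNneq x_neq0 => f_eq0; apply/eqP/rowP => j.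
  by rewrite -[j]enum_valK -fE f_eq0 ffunE mxE.
- move=> v fv; apply/(mem_vertex hnk).
  by apply: contraNT fv => /f0 ->; exact: eqxx.
apply/ffunP => v; rewrite [RHS]ffunE.
have [vV|vV] := boolP ((num1 v == k) && (numX v == n)).
  have -> : v = val (Sub v vV : V) by rewrite SubK.
  rewrite khovanov_signless fE.
  have /rowP/(_ (enum_rank (Sub v vV : V))) := xQ.
  rewrite mul_signless ?[RHS]mxE; last exact: weight_sym.
  by rewrite enum_rankK => <-; apply: eq_bigr => u _; rewrite fE.
rewrite khovanov_laplacianE f0 // mulr0 big1 // => i _.
by rewrite mulr0 add0r f0 ?mulr0 // num1_swap numX_swap.
Qed.

End Khovanov.

(** * Degrees *)

Section Degrees.
Variables (R : realType) (N n k : nat).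
Local Notation V := (TU_vertex N n k).
Local Notation w := (@TU_weight R N n k).

Lemma degreeE (v : V) :
  degree w v = \sum_(i < N) ((site (val v) i != site (val v) i.+1)%:R
                 + (site (val v) i && site (val v) i.+1)%:R / 2).
Proof.
rewrite /degree; under eq_bigr => u _ do rewrite -[w v u]mulr1.
rewrite (weight_sum idfun v (fun=> 1)); apply: eq_bigr => i _ /=.
by rewrite site_above site_below !mulr1 mul1r.
Qed.

(** Each crossing contributes at most the number of its two entries equal to 𝟙,
and each entry belongs to at most two crossings. *)
Lemma degree_le (v : V) : degree w v <= 2 * k%:R.
Proof.
have siteS : (\sum_(i < N) site (val v) i.+1 <= k)%N.
  apply: leq_trans (height_vertex v (leqnn N.+1)).
  by rewrite /height big_ord_recl leq_addl.
have site0 : (\sum_(i < N) site (val v) i <= k)%N.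
  by rewrite -/(height _ N) height_vertex.
apply: le_trans
  (_ : \sum_(i < N) ((site (val v) i)%:R + (site (val v) i.+1)%:R) <= _).
  rewrite degreeE; apply: ler_sum => i _.
  by case: (site _ i) (site _ i.+1) => [] [] /=; lra.
rewrite big_split /= -!natr_sum mulr_natl mulr2n.
by rewrite lerD // ler_nat.
Qed.

Lemma max_degree_ge (v : V) : degree w v <= max_degree w.
Proof. exact: le_bigmax. Qed.

Lemma max_degree_le : max_degree w <= 2 * k%:R.
Proof. by apply: bigmax_le => [|v _]; rewrite ?mulr_ge0 ?degree_le. Qed.

Lemma loop_le_degree (v : V) : w v v <= degree w v.
Proof.
by rewrite /degree (bigD1 v) //= lerDl sumr_ge0 // => u _; apply: weight_ge0.
Qed.

Hypothesis hnk : (n + k)%N = N.+1.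

Lemma vertex_subproof (A : {set 'I_N.+1}) : #|A| = k ->
  (num1 [ffun j => j \in A] == k) && (numX [ffun j => j \in A] == n).
Proof using hnk.
move=> Ak; have v1 : num1 [ffun j => j \in A] = k.
  by rewrite -Ak; apply: eq_card => j; rewrite inE ffunE.
by rewrite v1 eqxx -(eqn_add2l k) -{1}v1 num1X -hnk addnC eqxx.
Qed.

Definition vertex_of (A : {set 'I_N.+1}) (Ak : #|A| = k) : V :=
  Sub [ffun j => j \in A] (vertex_subproof Ak).

Lemma vertex_exists : (0 < #|{: V}|)%N.
Proof using hnk.
have : (0 < #|[set A : {set 'I_N.+1} | #|A| == k]|)%N.
  by rewrite card_draws card_ord bin_gt0 -hnk leq_addl.
case/card_gt0P => A; rewrite inE => /eqP Ak.
by apply/card_gt0P; exists (vertex_of Ak).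
Qed.

(** Two isolated symbols 𝟙 away from both ends can each move in two directions;
N >= 4 leaves room for them at positions 1 and 3. *)
Lemma max_degree_two_ones : k = 2%N -> (4 <= N)%N -> max_degree w = 4.
Proof using hnk.
move=> k2 N4; apply/le_anti/andP; split.
  by apply: (le_trans max_degree_le); rewrite k2; lra.
pose A : {set 'I_N.+1} := [set inord 1; inord 3].
have inordE j l : (j <= N)%N -> (l <= N)%N ->
    (inord j == inord l :> 'I_N.+1) = (j == l).
  by move=> jN lN; rewrite -val_eqE /= !inordK.
have Ak : #|A| = k.
  by rewrite cards2 inordE // ?k2 // (leq_trans _ N4).
pose v := vertex_of Ak.
apply: le_trans (max_degree_ge v); rewrite degreeE.
have siteE j : (j <= 4)%N -> site (val v) j = (j == 1%N) || (j == 3%N).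
  by move=> j4; rewrite /site SubK ffunE !inE !inordE // (leq_trans _ N4).
pose F i : R := (site (val v) i != site (val v) i.+1)%:R
                 + (site (val v) i && site (val v) i.+1)%:R / 2.
rewrite -(big_mkord xpredT F) (@big_cat_nat _ _ _ 4) //=.
rewrite big_mkord 4!big_ord_recr big_ord0 /= /F !siteE //=.
have : 0 <= \sum_(4 <= i < N) F i.
  by apply: sumr_ge0 => i _; rewrite addr_ge0 // divr_ge0.
by rewrite /F; lra.
Qed.

(** By [loop_sum] the graph has a loop as soon as Psi_value is nonzero, and a loop
has weight at least 1/2. *)
Lemma Psi_value_max_degree : Psi_value R N k != 0 -> 1 / 2 <= max_degree w.
Proof using hnk.
apply: contraNT; rewrite -ltNge => d_small.
have loop0 (v : V) : w v v = 0.
  have : w v v < 1 / 2.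
    apply: le_lt_trans d_small.
    exact: le_trans (loop_le_degree v) (max_degree_ge v).
  rewrite weight_loop => w_small; apply: big1 => i _.
  case: (boolP (_ && _)) => [vi|]; last by rewrite mul0r.
  move: w_small; rewrite (bigD1 i) //= vi gtrDl ltNge sumr_ge0 // => j _.
  by rewrite divr_ge0.
have := loop_sum (@weight_sym R N n k) (@potential_laplacian R N n k).
rewrite big1 // => /esym/eqP; rewrite mulf_eq0 => /orP[//|].
by rewrite pnatr_eq0 -leqn0 leqNgt vertex_exists.
Qed.

End Degrees.

(** * The bounds for the twisted unknot *)

Theorem corollary41 (R : realType) (N n k : nat)
    (hnk : (n + k)%N = N.+1) (hk : (k <= 2)%N) :
  let w := @TU_weight R N n k in
  let Q := signless_laplacian_mx w in
  let Psi_V := Psi_of w [set: TU_vertex N n k] in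
  let dstar := max_degree w in
  let B : R := 2 * k%:R * (k%:R - 1) / N.+1%:R in
  Psi w = Psi_V /\
  ((4 <= N)%N ->
     Psi_V ^+ 2 / (4 * dstar)
       = 1 / 16 * (k%:R * (k%:R - 1) / (2 * N.+1%:R)) ^+ 2) /\
  exists lambda_min : R,
    [/\ smallest (eigenvalue Q) lambda_min,
        smallest (@khovanov_eigenvalue R N (k%:Z - n%:Z))
                 (real_complex R lambda_min),
        Psi_V ^+ 2 / (4 * dstar) <= 1 / 16 * B ^+ 2,
        1 / 16 * B ^+ 2 <= lambda_min
      & lambda_min <= B /\ B = 4 * Psi_V].
Proof.
move=> w Q Psi_V dstar B.
have w_sym := @weight_sym R N n k; have w_ge0 := @weight_ge0 R N n k.
have g_lap := @potential_laplacian R N n k.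
have c_proper := @height_parity_proper R N n k.
have V_gt0 := vertex_exists hnk.
have Psi_VE : Psi_V = Psi_value R N k by apply: Psi_setT g_lap _ c_proper _.
have N1_gt0 : 0 < N.+1%:R :> R by rewrite ltr0n.
have BE : B = 4 * Psi_value R N k.
  by rewrite /B /Psi_value; field; rewrite nat1r pnatr_eq0.
have Psi_ge0 : 0 <= Psi_value R N k.
  rewrite /Psi_value divr_ge0 //; last by rewrite mulr_ge0.
  by case: (k) hk => [|[|[|]]] // _; lra.
split.
  exact: (Psi_minimum w_sym w_ge0 g_lap c_proper V_gt0 (potential_gradient hk)).
split=> [N4|].
  rewrite Psi_VE /Psi_value.
  have [k2|k_neq2] := eqVneq k 2%N.
    by rewrite /dstar max_degree_two_ones // k2; field; rewrite nat1r pnatr_eq0.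
  have -> : k%:R * (k%:R - 1) = 0 :> R.
    by case: (k) hk k_neq2 => [|[|[|]]] // _ _; ring.
  by rewrite !mul0r expr0n /= mul0r mulr0.
have [a [a_min a_min_C a_le]] := signless_smallest w_sym V_gt0 c_proper.
exists a; split=> //.
- split; first by apply/(khovanov_eigenvalueE hnk); case: a_min_C.
  by move=> b /(khovanov_eigenvalueE hnk); apply: a_min_C.2.
- rewrite Psi_VE BE; have [->|Psi_neq0] := eqVneq (Psi_value R N k) 0.
    by rewrite mulr0 expr0n /= mul0r mulr0.
  have d_ge := Psi_value_max_degree hnk Psi_neq0.
  have d_ge1 : 1 <= 4 * dstar by rewrite -/w -/dstar in d_ge; lra.
  rewrite ler_pdivrMr; last exact: lt_le_trans d_ge1.
  have := ler_wpM2l (sqr_ge0 (Psi_value R N k)) d_ge1; lra.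
- have -> : 1 / 16 * B ^+ 2 = Psi_value R N k ^+ 2 by rewrite BE; field.
  pose h (u : TU_vertex N n k) := potential R k (val u) + N.+1%:R / 2.
  apply: (@eigenvalue_lower_bound _ _ _ w_sym w_ge0 _ _ h) a_min.1 => u.
    by case: (potential_superharmonic R hk u).
  by case: (potential_superharmonic R hk u).
split; last by rewrite BE Psi_VE.
have : a <= 2 * Psi_value R N k.
  rewrite -(ler_pM2r (_ : 0 < #|{: TU_vertex N n k}|%:R)) ?ltr0n //.
  by rewrite -mulrA -(loop_sum w_sym g_lap).
by rewrite BE; lra.
Qed.
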